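(* Let $\dot x=B(t)x+s(t)$, $t\in I=(\tau,\infty)$, be a nonautonomous compartmental system with $d$ pools (see context), and fix a solution $t\mapsto x(t)=(x_1(t),\dots,x_d(t))$ on $I$ with positive entries that are bounded and bounded away from zero. Suppose that, for some $m\ge1$ and positive integers $d_1,\dots,d_m$ with $\sum_{i=1}^m d_i=d$, the function $B$ is lower block triangular, $B(t)=(B_{kl}(t))_{k,l\in\{1,\dots,m\}}$ with bounded functions $B_{kl}:I\to\mathbb{R}^{d_k\times d_l}$ and $B_{kl}(t)=0$ for $k<l$, and that there is $\delta>0$ such that for every $n\in\{1,\dots,m\}$: (i) $(B_{nn}(t))_{ii}<0$ for all $t\in I$, $i\in\{1,\dots,d_n\}$; (ii) $(B_{nn}(t))_{ij}\ge0$ for all $t\in I$, $i\ne j\in\{1,\dots,d_n\}$; (iii) $\sum_{j=1}^{d_n}(B_{nn}(t))_{ij}\le-\delta$ for all $t\in I$, $i\in\{1,\dots,d_n\}$. In addition, assume that (a) $s_i(t)\ge\delta$ for all $t\in I$ and $i\in\{1,\dots,d_1\}$, and (b) for all $n\in\{2,\dots,m\}$ and $i\in\{1+\sum_{k=1}^{n-1}d_k,\dots,\sum_{k=1}^{n}d_k\}$, there exists $j\in\{1,\dots,\sum_{k=1}^{n-1}d_k\}$ such that $b_{ij}(t)\ge\delta$ for all $t\in I$. Then the mean age system $\dot{\bar a}=A(t,x(t))\bar a+(1,\dots,1)^T$ (see context) is exponentially stable. More precisely, there exist $\bar\delta\in(0,\delta)$ and $\bar K>0$ such that the transition operator $\Psi:I\times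 I\to\mathbb{R}^{d\times d}$ of the homogeneous equation $\dot{\bar a}=A(t,x(t))\bar a$ satisfies $$\|\Psi(t,t_0)\|\le\bar K e^{-\bar\delta(t-t_0)}\quad\text{for all } t\ge t_0>\tau.$$
   Context: Nonautonomous compartmental system: $I=(\tau,\infty)$ with $\tau\in\{-\infty\}\cup\mathbb{R}$; $B:I\to\mathbb{R}^{d\times d}$ is a bounded continuous function whose values are invertible matrices; $s:I\to[0,\infty)^d$ is bounded and continuous; the entries $b_{ij}(t)$ of $B(t)$ satisfy $b_{ii}(t)<0$ for all $i$ and $t\in I$, $b_{ij}(t)\ge 0$ for all $i\ne j$ and $t\in I$, and $\sum_{i=1}^d b_{ij}(t)\le 0$ for all $j$ and $t\in I$. The system is $\dot x=B(t)x+s(t)$. Mean age system: for a solution $x(t)$ with positive entries it is $$\dot{\bar a}_i=1+\frac{\sum_{j=1}^d(\bar a_j-\bar a_i)b_{ij}(t)x_j(t)-\bar a_is_i(t)}{x_i(t)},\quad i\in\{1,\dots,d\},$$ equivalently $\dot{\bar a}=A(t,x(t))\bar a+(1,\dots,1)^T$, where $A(t,x(t))\in\mathbb{R}^{d\times d}$ has off-diagonal entries $A_{ij}=\frac{b_{ij}(t)x_j(t)}{x_i(t)}$ for $i\neq j$ and diagonal entries $A_{ii}=\frac{-s_i(t)-\sum_{j\ne i}b_{ij}(t)x_j(t)}{x_i(t)}$. The transition operator $\Psi$ of $\dot{\bar a}=A(t,x(t))\bar a$ is defined by: $t\mapsto\Psi(t,t_0)a_0$ is the solution with value $a_0$ at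 $t=t_0$. $\|\cdot\|$ is a matrix norm. *)

(* Defs.v *)
From mathcomp Require Import all_boot all_order all_algebra.
From mathcomp Require Import all_classical all_reals all_analysis.
From mathcomp Require Import ring.
Set Implicit Arguments.
Unset Strict Implicit.
Unset Printing Implicit Defensive.
Import Order.TTheory GRing.Theory Num.Theory numFieldNormedType.Exports.
Local Open Scope classical_set_scope.
Local Open Scope ring_scope.

(* (tau, oo); the extended real [tau] is meant to be -oo or finite. *)
Definition time_interval (R : realType) (tau : \bar R) : set R :=
  [set t | (tau < t%:E)%E].

Record compartmental (R : realType) (d : nat) (I : set R)
    (B : R -> 'M[R]_d) (s : R -> 'cV[R]_d) : Prop := Compartmental {
  comp_B_continuous : {within I, continuous B} ;
  comp_B_bounded : [bounded B t | t in I] ;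
  comp_B_invertible : forall t, I t -> B t \in unitmx ;
  comp_s_continuous : {within I, continuous s} ;
  comp_s_bounded : [bounded s t | t in I] ;
  comp_s_ge0 : forall t i, I t -> 0 <= s t i 0 ;
  comp_B_diag : forall t i, I t -> B t i i < 0 ;
  comp_B_offdiag : forall t i j, I t -> i != j -> 0 <= B t i j ;
  comp_B_colsum : forall t j, I t -> \sum_i B t i j <= 0 }.

Definition ode_solution (R : realType) (d : nat) (I : set R)
    (f : R -> 'cV[R]_d -> 'cV[R]_d) (x : R -> 'cV[R]_d) : Prop :=
  forall t, I t -> is_derive t 1 x (f t (x t)).

Definition mean_age_field (R : realType) (d : nat) (B : R -> 'M[R]_d)
    (s x : R -> 'cV[R]_d) (t : R) (a : 'cV[R]_d) : 'cV[R]_d :=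
  \col_i (1 + (\sum_j (a j 0 - a i 0) * B t i j * x t j 0 - a i 0 * s t i 0)
              / x t i 0).

Definition mean_age_mx (R : realType) (d : nat) (B : R -> 'M[R]_d)
    (s x : R -> 'cV[R]_d) (t : R) : 'M[R]_d :=
  \matrix_(i, j)
    if i == j then
      (- s t i 0 - \sum_(k | k != i) B t i k * x t k 0) / x t i 0
    else B t i j * x t j 0 / x t i 0.

Lemma mean_age_fieldE (R : realType) (d : nat) (B : R -> 'M[R]_d)
    (s x : R -> 'cV[R]_d) (t : R) (a : 'cV[R]_d) :
  mean_age_field B s x t a = mean_age_mx B s x t *m a + const_mx 1.
Proof.
apply/matrixP => i j; rewrite !mxE addrC; congr (_ + _).
rewrite [in LHS](bigD1 i)//= subrr !mul0r add0r.
rewrite [in RHS](bigD1 i)//= !mxE eqxx (ord1 j).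
have -> : \sum_(k | k != i) (a k 0 - a i 0) * B t i k * x t k 0 =
    \sum_(k | k != i) B t i k * x t k 0 * a k 0
    - (\sum_(k | k != i) B t i k * x t k 0) * a i 0.
  by rewrite mulr_suml -sumrB; apply: eq_bigr => k _; ring.
have -> : \sum_(k | k != i) mean_age_mx B s x t i k * a k 0 =
    (\sum_(k | k != i) B t i k * x t k 0 * a k 0) / x t i 0.
  rewrite mulr_suml; apply: eq_bigr => k ki.
  by rewrite mxE eq_sym (negbTE ki); ring.
by ring.
Qed.

(* [Psi] is only constrained on I x I, where these conditions determine it. *)
Definition is_transition_operator (R : realType) (d : nat) (I : set R)
    (A : R -> 'M[R]_d) (Psi : R -> R -> 'M[R]_d) : Prop :=
  forall t0, I t0 -> forall a0 : 'cV[R]_d,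
    ode_solution I (fun t a => A t *m a) (fun t => Psi t t0 *m a0) /\
    Psi t0 t0 *m a0 = a0.

(* Any norm on the space of matrices; submultiplicativity is not required. *)
Definition matrix_norm (R : realType) (d : nat) (N : 'M[R]_d -> R) : Prop :=
  [/\ forall M, N M = 0 -> M = 0,
      forall (c : R) M, N (c *: M) = `|c| * N M &
      forall M M', N (M + M') <= N M + N M'].

(* Main.v *)
Require Import Defs.
From mathcomp Require Import all_boot all_order all_algebra.
From mathcomp Require Import all_classical all_reals all_analysis.
From mathcomp Require Import ring lra.
Set Implicit Arguments.
Unset Strict Implicit.
Unset Printing Implicit Defensive.
Import Order.TTheory GRing.Theory Num.Theory numFieldNormedType.Exports.
Local Open Scope classical_set_scope.
Local Open Scope ring_scope.

(* Weight the coordinates of block n (counted from 1) by v = n.  The mean age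
   matrix A has nonnegative off-diagonal entries and row sums - s_i / x_i, and
   the block structure makes A_ij vanish whenever v_j > v_i, so (a) and (b)
   give A v <= - e v entrywise for some e > 0.  By the maximum principle, for
   every r < e the weighted sup norm max_i |a_i| / v_i of a solution of
   a' = A a decays at rate r. *)

(** * Maximum principle for linear systems with nonnegative off-diagonal entries *)

(** Difference quotients with [h < 0] have numerator and denominator both nonpositive. Only the left
    side is used, since the maximum may sit at the right end of the time interval. *)
Lemma derive_ge0_left_max (R : realType) (f : R -> R) (a c df : R) :
  a < c -> is_derive c 1 f df -> (forall t, a <= t <= c -> f t <= f c) ->
  0 <= df.
Proof.
move=> ac [fc <-] fmax; rewrite ['D_1 f c]cvg_at_leftE//.
apply: limr_ge.
  rewrite -(cvg_at_leftE (fun h => h^-1 *: ((f \o shift c) _ - f c)))//.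
  apply: cvg_trans fc; apply: cvg_app => A [e e0 Ae].
  by exists e => // x xe x0; apply: Ae => //; exact/ltr0_neq0.
near=> h; apply: mulr_le0.
  by rewrite invr_le0; apply: ltW; near: h; exists 1 => /=.
rewrite subr_le0 [_%:A]mulr1; apply: fmax.
have h0 : h < 0 by near: h; exists 1 => /=.
rewrite -lerBlDr; apply/andP; split; last by rewrite /= gerDr ltW.
near: h; exists (c - a); first by rewrite /= subr_gt0.
by move=> h /=; rewrite sub0r normrN => /ltr_normlP[]; lra.
Unshelve. all: by end_near. Qed.

Lemma is_derive_coord (R : realFieldType) (m n : nat) (M : R -> 'M[R]_(m, n))
    (dM : 'M[R]_(m, n)) (t v : R) i j :
  is_derive t v M dM -> is_derive t v (fun t => M t i j) (dM i j).
Proof.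
move=> [Mt <-]; rewrite (derive_mx Mt) mxE.
by apply/derivableP; exact: (derivable_mxP M t v).1.
Qed.

(* At a maximum of [y_i e^(r (t - t0)) / v_i] over the index and the time that
   is positive and attained after [t0], the derivative is at most [r - e] times
   that maximum. *)
Lemma metzler_upper_bound (R : realType) (d : nat) (A : R -> 'M[R]_d)
    (y : R -> 'cV[R]_d) (v : 'I_d -> R) (e r t0 M : R) :
  (forall t i j, t0 <= t -> i != j -> 0 <= A t i j) ->
  (forall i, 0 < v i) ->
  (forall t i, t0 <= t -> \sum_j A t i j * v j <= - e * v i) ->
  r < e -> 0 <= M ->
  (forall t, t0 <= t -> is_derive t 1 y (A t *m y t)) ->
  (forall i, y t0 i 0 <= M * v i) ->
  forall t i, t0 <= t -> y t i 0 <= M * v i * expR (- r * (t - t0)).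
Proof.
move=> A0 v0 Av re M0 dy y0 T i0 t0T.
pose u i t := expR (r * (t - t0)) * (y t i 0 / v i).
pose du i t := expR (r * (t - t0)) * (r * (y t i 0 / v i)
  + (\sum_j A t i j * y t j 0) / v i).
have uD i t : t0 <= t -> is_derive t 1 (u i) (du i t).
  move=> t0t; have yi := is_derive_coord i 0 (dy _ t0t).
  have -> : u i = (expR \o (fun t => r * (t - t0))) *
                  ((v i)^-1 \*: (fun t => y t i 0)).
    by apply/funext => z; rewrite /u /= fctE /= /GRing.scale /=; ring.
  have dl : is_derive t 1 (fun t => r * (t - t0)) r.
    have -> : (fun t => r * (t - t0)) = r \*: (id - cst t0) by apply/funext.
    by apply: is_derive_eq; rewrite subr0 /GRing.scale /= mulr1.
  apply: is_derive_eq; rewrite /du mxE /= /GRing.scale /=.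
  by ring.
have uc i : {within `[t0, T], continuous (u i)}.
  apply: derivable_within_continuous => t; rewrite in_itv/= => /andP[t0t _].
  by have [] := uD i t t0t.
(* [c i] is a time in [[t0, T]] maximizing [u i], and [k] is the index whose maximum is largest, so
   [u k (c k)] dominates every [u j t] on the interval. *)
pose c i := sval (cid2 (EVT_max t0T (uc i))).
have cT i : t0 <= c i <= T.
  by rewrite /c; case: cid2 => /= z; rewrite in_itv.
have cmax i t : t0 <= t <= T -> u i t <= u i (c i).
  by rewrite /c; case: cid2 => /= z _ zmax tT; apply: zmax; rewrite in_itv.
have [k _ kmax] := @arg_maxP _ _ _ i0 xpredT (fun i => u i (c i)) isT.
suff uM : u k (c k) <= M.
  have : u i0 T <= M.
    by apply: le_trans uM; apply: le_trans (kmax i0 isT);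
       apply: cmax; rewrite t0T lexx.
  rewrite /u mulNr expRN -mulrA (mulrC (v i0)) mulrA.
  by rewrite mulrA ler_pdivrMr// mulrAC -ler_pdivlMl ?expR_gt0// mulrC mulrAC.
rewrite leNgt; apply/negP => Mu.
have /andP[t0c cTk] := cT k.
(* At time [t0] the value [u k t0] is at most [M], so a maximum above [M] occurs strictly later and
   has a left neighbourhood. *)
have {}t0c : t0 < c k.
  rewrite lt_neqAle t0c andbT; apply: contraTN Mu => /eqP <-.
  by rewrite -leNgt /u subrr mulr0 expR0 mul1r ler_pdivrMr.
suff : du k (c k) < 0.
  rewrite ltNge => /negP; apply.
  apply: (derive_ge0_left_max t0c (uD k _ (ltW t0c))) => t /andP[t0t tc].
  by apply: cmax; rewrite t0t (le_trans tc).
set S := c k in Mu t0c cTk *; set m := u k S in Mu *.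
have E0 := expR_gt0 (r * (S - t0)).
have m0 : 0 < m by exact: le_lt_trans Mu.
suff : du k S <= (r - e) * m.
  by move=> /le_lt_trans; apply; rewrite nmulr_rlt0// subr_lt0.
have -> : du k S = r * m + (\sum_j A S k j * (v j * u j S)) / v k.
  rewrite /du /m /u mulrDr mulrCA; congr (_ + _).
  rewrite !mulr_suml mulr_sumr; apply: eq_bigr => j _.
  by field; rewrite !lt0r_neq0.
rewrite mulrBl lerD2l ler_pdivrMr//.
apply: (@le_trans _ _ (\sum_j A S k j * v j * m)); last first.
  rewrite -mulr_suml (_ : - (e * m) * v k = - e * v k * m); last by ring.
  by rewrite ler_pM2r// Av// ltW.
(* The diagonal term is an equality because [m] is [u k S]. Off the diagonal, [A S k j >= 0] allows
   replacing [u j S] by its upper bound [m]. *)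
apply: ler_sum => j _; rewrite mulrA.
have [<-//|kj] := eqVneq k j.
apply: ler_wpM2l; first by rewrite mulr_ge0 ?(ltW (v0 j))// A0// ltW.
by apply: le_trans (kmax j isT); apply: cmax; rewrite (ltW t0c).
Qed.

(** By linearity [- y] solves the same equation, so the upper bound applies to both [y] and
    [- y]. *)
Lemma metzler_bound (R : realType) (d : nat) (A : R -> 'M[R]_d)
    (y : R -> 'cV[R]_d) (v : 'I_d -> R) (e r t0 M : R) :
  (forall t i j, t0 <= t -> i != j -> 0 <= A t i j) ->
  (forall i, 0 < v i) ->
  (forall t i, t0 <= t -> \sum_j A t i j * v j <= - e * v i) ->
  r < e -> 0 <= M ->
  (forall t, t0 <= t -> is_derive t 1 y (A t *m y t)) ->
  (forall i, `|y t0 i 0| <= M * v i) ->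
  forall t i, t0 <= t -> `|y t i 0| <= M * v i * expR (- r * (t - t0)).
Proof.
move=> A0 v0 Av re M0 dy y0 t i t0t.
have dyN z : t0 <= z -> is_derive z 1 (- y) (A z *m (- y) z).
  by move=> /dy; rewrite mulmxN; exact: is_deriveN.
have yN z j : (- y) z j 0 = - y z j 0 by rewrite fctE mxE.
rewrite ler_norml lerNl -yN; apply/andP; split.
  apply: (metzler_upper_bound A0 v0 Av re M0 dyN) => // j.
  by rewrite yN (le_trans _ (y0 j))// -normrN ler_norm.
apply: (metzler_upper_bound A0 v0 Av re M0 dy) => // j.
by rewrite (le_trans (ler_norm _)).
Qed.

(** * Arbitrary matrix norms and entrywise bounds *)

(** Expanding [M] in the basis of matrix units reduces decay in any norm to decay of the entries. *)
Lemma matrix_norm_le_entries (R : realType) (d : nat) (N : 'M[R]_d -> R) :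
  matrix_norm N ->
  forall M, N M <= \sum_i \sum_j `|M i j| * N (delta_mx i j).
Proof.
move=> [_ NZ ND] M; rewrite [in N M](matrix_sum_delta M).
have N0 : N 0 <= 0 by rewrite -(scale0r 0) NZ normr0 mul0r.
have Nsum (F : 'I_d -> 'M[R]_d) : N (\sum_i F i) <= \sum_i N (F i).
  elim/big_ind2 : _ => // a b a' b' ba ba'.
  by rewrite (le_trans (ND _ _))// lerD.
apply: le_trans (Nsum _) _; apply: ler_sum => i _.
apply: le_trans (Nsum _) _; apply: ler_sum => j _.
by rewrite NZ.
Qed.

Lemma matrix_norm_ge0 (R : realType) (d : nat) (N : 'M[R]_d -> R) :
  matrix_norm N -> forall M, 0 <= N M.
Proof.
move=> [_ NZ ND] M; have := ND M (- 1 *: M).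
rewrite NZ normrN normr1 mul1r scaleN1r subrr -(scale0r 0) NZ normr0 mul0r.
by rewrite -mulr2n pmulrn_lge0.
Qed.

Lemma bounded_entries (R : realType) (T : Type) (m n : nat)
    (f : T -> 'M[R]_(m, n)) (D : set T) :
  [bounded f t | t in D] ->
  exists2 X, 0 < X & forall t i j, D t -> `|f t i j| <= X.
Proof.
move=> /ex_strict_bound_gt0 [X X0 fX]; exists X => // t i j Dt.
apply: le_trans (ltW (fX t Dt)).
by rewrite [leRHS]/Num.Def.normr/= mx_normrE; exact: (le_bigmax _ _ (i, j)).
Qed.

(** * The weighted row sums of the mean age matrix *)

(** In row [i], the numerator is at most [- delta * min c 1]: the inflow contributes at most
    [- delta], or a link to a lower level [j] contributes at most [- delta * c], and all other terms
    are nonpositive. Dividing by [x t i 0 <= X] and using [v i <= m] gives the rate. *)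
Lemma mean_age_mx_weight (R : realType) (d : nat) (I : set R)
    (B : R -> 'M[R]_d) (s x : R -> 'cV[R]_d) (m : nat) (v : 'I_d -> nat)
    (delta c X : R) :
  compartmental I B s -> 0 < delta -> 0 < c -> 0 < X ->
  (forall t i, I t -> c <= x t i 0 <= X) ->
  (forall i, 0 < v i <= m)%N ->
  (forall t i j, I t -> (v i < v j)%N -> B t i j = 0) ->
  (forall i, (forall t, I t -> delta <= s t i 0) \/
     exists2 j, (v j < v i)%N & forall t, I t -> delta <= B t i j) ->
  forall t i, I t -> \sum_j mean_age_mx B s x t i j * (v j)%:R <=
    - (delta * Num.min c 1 / X / m%:R) * (v i)%:R.
Proof.
move=> hB delta0 c0 X0 xcX vm Bv level t i It.
have [cx xX] := andP (xcX t i It).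
have [vi0 vim] := andP (vm i).
have x0 j : 0 < x t j 0 by rewrite (lt_le_trans c0)//; have /andP[] := xcX t j It.
have s0 := comp_s_ge0 hB i It.
pose g j : R := ((v j)%:R - (v i)%:R) * B t i j * x t j 0.
have -> : \sum_j mean_age_mx B s x t i j * (v j)%:R =
    (\sum_j g j - (v i)%:R * s t i 0) / x t i 0.
  (* The mean age field at the weight vector is [A v] plus the constant 1; cancelling that 1
     expresses [A v] through the differences [v j - v i]. *)
  have /matrixP/(_ i 0) := mean_age_fieldE B s x t (\col_j (v j)%:R).
  rewrite !mxE [RHS]addrC => /addrI ageE.
  transitivity (\sum_j mean_age_mx B s x t i j * (\col_j (v j)%:R : 'cV[R]_d) j 0).
    by apply: eq_bigr => j _; congr (_ * _); rewrite mxE.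
  rewrite -ageE; congr ((_ - _) / _); apply: eq_bigr => j _.
  by rewrite !mxE.
have g0 j : g j <= 0.
  have [vij|vji] := ltnP (v i) (v j); first by rewrite /g Bv// mulr0 mul0r.
  rewrite pmulr_lle0//; have [->|ij] := eqVneq i j; first by rewrite subrr mul0r.
  by rewrite mulr_le0_ge0 ?(comp_B_offdiag hB)// subr_le0 ler_nat.
set mn := Num.min c 1.
have mn0 : 0 < mn by rewrite lt_min c0 ltr01.
suff key : \sum_j g j - (v i)%:R * s t i 0 <= - (delta * mn).
  have m0 : (0 : R) < m%:R by rewrite ltr0n (leq_trans vi0).
  (* The bound on the numerator is negative, so enlarging the denominator to [X] and then
     multiplying by [v i / m <= 1] only weakens it. *)
  apply: (@le_trans _ _ (- (delta * mn) / x t i 0)).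
    by rewrite ler_pM2r ?invr_gt0.
  apply: (@le_trans _ _ (- (delta * mn) / X)).
    by rewrite !mulNr lerN2 ler_pM2l ?mulr_gt0// lef_pV2 ?posrE.
  rewrite !mulNr lerN2 -[leLHS]mulrA ger_pMr ?divr_gt0 ?mulr_gt0//.
  by rewrite ler_pdivrMl// mulr1 ler_nat.
have [ds|[j vji dB]] := level i.
  rewrite -[leRHS]add0r lerD ?sumr_le0// lerN2.
  apply: (@le_trans _ _ (1 * delta)).
    by rewrite mulrC ler_pM2r// ge_min lexx orbT.
  by rewrite ler_pM ?ler1n ?(ltW delta0) ?ds.
rewrite -[leRHS]addr0 lerD ?oppr_le0 ?mulr_ge0//.
rewrite (bigD1 j)//= -[leRHS]addr0 lerD ?sumr_le0//.
rewrite /g -opprB !mulNr lerN2 -natrB ?(ltnW vji)// -[leLHS]mul1r -mulrA.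
have /andP[cxj _] := xcX t j It.
rewrite ler_pM ?mulr_ge0 ?(ltW mn0) ?(ltW delta0)// ?ler1n ?subn_gt0//.
by rewrite ler_pM ?(ltW mn0) ?(ltW delta0) ?dB// (le_trans _ cxj)// ge_min lexx.
Qed.

(** * Decay of the transition operator *)

Lemma mean_age_transition_bound (R : realType) (tau : \bar R) (d : nat)
    (B : R -> 'M[R]_d) (s x : R -> 'cV[R]_d) (m : nat) (v : 'I_d -> nat)
    (delta c : R) (N : 'M[R]_d -> R) (Psi : R -> R -> 'M[R]_d) :
  let I := time_interval tau in
  compartmental I B s -> 0 < delta -> 0 < c ->
  [bounded x t | t in I] ->
  (forall t i, I t -> c <= x t i 0) ->
  (0 < m)%N ->
  (forall i, 0 < v i <= m)%N ->
  (forall t i j, I t -> (v i < v j)%N -> B t i j = 0) ->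
  (forall i, (forall t, I t -> delta <= s t i 0) \/
     exists2 j, (v j < v i)%N & forall t, I t -> delta <= B t i j) ->
  matrix_norm N ->
  is_transition_operator I (mean_age_mx B s x) Psi ->
  exists delta' K : R,
    [/\ 0 < delta', delta' < delta, 0 < K &
        forall t t0, I t0 -> t0 <= t ->
          N (Psi t t0) <= K * expR (- delta' * (t - t0))].
Proof.
move=> I hB delta0 c0 /bounded_entries[X X0 xX] cx m0 vm Bv level hN hPsi.
have xcX t i : I t -> c <= x t i 0 <= X.
  by move=> It; rewrite cx//= (le_trans (ler_norm _))// xX.
have weight := mean_age_mx_weight hB delta0 c0 X0 xcX vm Bv level.
set e := delta * _ / X / _ in weight.
have e0 : 0 < e.
  by rewrite !divr_gt0 ?ltr0n// mulr_gt0// lt_min c0 ltr01.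
(* Halving the minimum puts the rate strictly below both [e] and [delta]. *)
pose r := Num.min e delta / 2.
have r0 : 0 < r by rewrite divr_gt0// lt_min e0.
have rmin : r < Num.min e delta by rewrite /r; move: r0; rewrite /r; lra.
have re : r < e by rewrite (lt_le_trans rmin)// ge_min lexx.
have rdelta : r < delta by rewrite (lt_le_trans rmin)// ge_min lexx orbT.
pose K := \sum_i \sum_j (v i)%:R * N (delta_mx i j).
have N0 := matrix_norm_ge0 hN.
have K0 : 0 <= K.
  by apply: sumr_ge0 => i _; apply: sumr_ge0 => j _; rewrite mulr_ge0.
(* [K] is an empty sum when [d = 0]; adding 1 makes the constant positive. *)
exists r, (K + 1); split => //; first by rewrite ltr_wpDl.
move=> t t0 It0 t0t.
have It z : t0 <= z -> I z.
  by move=> t0z; apply: lt_le_trans It0 _; rewrite lee_fin.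
(* Column [j] of [Psi] is the solution starting at the [j]-th unit vector, which is bounded by the
   weights since each is at least 1; hence [M = 1] below. *)
have entry i j : `|Psi t t0 i j| <= (v i)%:R * expR (- r * (t - t0)).
  pose a0 : 'cV[R]_d := delta_mx j 0.
  have [Psisol Psi0] := hPsi _ It0 a0.
  have -> : Psi t t0 i j = (Psi t t0 *m a0) i 0 by rewrite -colE mxE.
  rewrite -[(v i)%:R]mul1r.
  apply: (metzler_bound (A := mean_age_mx B s x)
    (y := fun z => Psi z t0 *m a0) (v := fun k => (v k)%:R) (e := e)) => //.
  - move=> z k l /It Iz kl; rewrite mxE (negbTE kl) !mulr_ge0 ?invr_ge0//.
    + exact: (comp_B_offdiag hB).
    + by rewrite (le_trans (ltW c0))// cx.
    + by rewrite (le_trans (ltW c0))// cx.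
  - by move=> k; rewrite ltr0n; have /andP[] := vm k.
  - by move=> z k /It Iz; exact: weight.
  - by move=> z /It Iz; exact: Psisol.
  - move=> k; rewrite Psi0 mxE mul1r.
    have /andP[vk0 _] := vm k.
    by case: (_ && _); rewrite ?normr1 ?ler1n// normr0.
apply: le_trans (matrix_norm_le_entries hN _) _.
apply: (@le_trans _ _ (K * expR (- r * (t - t0)))); last first.
  by rewrite ler_pM2r ?expR_gt0// lerDl.
rewrite mulr_suml; apply: ler_sum => i _.
rewrite mulr_suml; apply: ler_sum => j _.
by rewrite mulrAC ler_wpM2r.
Qed.

(** * From block indices to levels *)

(** If the block of [i] were [k] or later, its offset, a lower bound for [i], would already contain
    all blocks before [k]. *)
Lemma tagnat_sig1_lt (n : nat) (p : 'I_n -> nat) (k : 'I_n)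
    (i : 'I_(\sum_i p i)%N) :
  (i < \sum_(l < n | (l < k)%N) p l)%N -> (tagnat.sig1 i < k)%N.
Proof.
apply: contraTT; rewrite -!leqNgt => ki.
rewrite tagnat.rect; apply: leq_trans (leq_addr _ _).
apply: (sub_le_big leqnn (fun a b => leq_addr b a)) => l /=.
by move=> /leq_trans; exact.
Qed.

Theorem theorem3 (R : realType) (tau : \bar R) (htau : tau != +oo%E)
  (d : nat) (B : R -> 'M[R]_d) (s : R -> 'cV[R]_d)
  (hcomp : compartmental (time_interval tau) B s)
  (x : R -> 'cV[R]_d)
  (hx : ode_solution (time_interval tau) (fun t y => B t *m y + s t) x)
  (hx_pos : forall t i, time_interval tau t -> 0 < x t i 0)
  (hx_bounded : [bounded x t | t in time_interval tau])
  (hx_away : exists2 c : R, 0 < c &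
     forall t i, time_interval tau t -> c <= x t i 0)
  (m : nat) (hm : (0 < m)%N) (dd : 'I_m -> nat)
  (hdd : forall k, (0 < dd k)%N) (hd : (\sum_(k < m) dd k)%N = d)
  (Bb : forall k l : 'I_m, R -> 'M[R]_(dd k, dd l))
  (hBb : forall t, time_interval tau t ->
     B t = castmx (hd, hd) (\mxblock_(k < m, l < m) Bb k l t))
  (hBb_bounded : forall k l, [bounded Bb k l t | t in time_interval tau])
  (hBb_lower : forall (k l : 'I_m) t, time_interval tau t -> (k < l)%N ->
     Bb k l t = 0)
  (delta : R) (hdelta : 0 < delta)
  (h_i : forall (n : 'I_m) t i, time_interval tau t -> Bb n n t i i < 0)
  (h_ii : forall (n : 'I_m) t i j, time_interval tau t -> i != j ->
     0 <= Bb n n t i j)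
  (h_iii : forall (n : 'I_m) t i, time_interval tau t ->
     \sum_j Bb n n t i j <= - delta)
  (h_a : forall t (i : 'I_d), time_interval tau t ->
     (i < dd (Ordinal hm))%N -> delta <= s t i 0)
  (h_b : forall (n : 'I_m) (i : 'I_d), (0 < n)%N ->
     (\sum_(k < m | (k < n)%N) dd k <= i < \sum_(k < m | (k <= n)%N) dd k)%N ->
     exists j : 'I_d, (j < \sum_(k < m | (k < n)%N) dd k)%N /\
       forall t, time_interval tau t -> delta <= B t i j)
  (N : 'M[R]_d -> R) (hN : matrix_norm N)
  (Psi : R -> R -> 'M[R]_d)
  (hPsi : is_transition_operator (time_interval tau) (mean_age_mx B s x) Psi) :
  exists delta' K : R,
    [/\ 0 < delta', delta' < delta, 0 < K &
        forall t t0, time_interval tau t0 -> t0 <= t ->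
          N (Psi t t0) <= K * expR (- delta' * (t - t0))].
Proof.
have [c c0 cx] := hx_away.
subst d.
have Bsig t i j : time_interval tau t ->
    B t i j = Bb (tagnat.sig1 i) (tagnat.sig1 j) t (tagnat.sig2 i) (tagnat.sig2 j).
  by move=> It; rewrite hBb// castmx_id mxE.
(* Blocks are numbered from 0 here, so the successor gives weights between 1 and [m]. *)
apply: (mean_age_transition_bound (v := fun i => (tagnat.sig1 i).+1) (m := m)
  hcomp hdelta c0 hx_bounded cx) => //.
  by move=> i; rewrite ltn_ord.
  by move=> t i j It ij; rewrite Bsig// hBb_lower// mxE.
move=> i; have [i0|i0] := posnP (tagnat.sig1 i).
  left=> t It; apply: h_a => //.
  have {}i0 : tagnat.sig1 i = Ordinal hm by exact: val_inj.
  rewrite tagnat.rect big_pred0; last by move=> k; rewrite i0.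
  by rewrite add0n -[X in (_ < dd X)%N]i0.
right; have [] := h_b (tagnat.sig1 i) i i0.
  (* [i] is the offset of its block plus a position smaller than the block size; splitting off the
     block's own term from the upper sum gives the range required by [h_b]. *)
  rewrite tagnat.rect leq_addr/= [ltnRHS](bigD1 (tagnat.sig1 i))//= addnC.
  rewrite -addSn leq_add// leq_eqVlt; apply/orP; left; apply/eqP.
  by apply: eq_bigl => l; rewrite ltn_neqAle andbC.
by move=> j [/tagnat_sig1_lt ji dB]; exists j.
Qed.
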